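(* Let $\lambda_1<0$ and $\rho>0$ be real numbers and put $l=\lambda_1^2/\rho^2$. Let $S=\{(x,y)\in\mathbb{R}^n\times\mathbb{R}:\|x\|^2\le y\}$ and $B=\{(x,y)\in\mathbb{R}^n\times\mathbb{R}:\|x\|^2\le y,\ y\ge l\}$, and let $\Pi_S,\Pi_B$ denote the orthogonal projections onto $S$ and $B$. For any point $(x_0,y_0)\in\mathbb{R}^n\times\mathbb{R}$, writing $(x_1,y_1)=\Pi_S(x_0,y_0)$, one has $$\Pi_B(x_0,y_0)=\begin{cases}(x_1,y_1) & \text{if } y_1\ge l,\\ (x_0,l) & \text{if } y_1<l \text{ and } \|x_0\|<\sqrt l,\\ \left(\sqrt l\, x_0/\|x_0\|,\ l\right) & \text{otherwise.}\end{cases}$$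
   Context: $\|\cdot\|$ denotes the Euclidean norm. For a closed convex set $C\subset\mathbb{R}^n\times\mathbb{R}$, the orthogonal projection is $\Pi_C(x,y)=\operatorname{argmin}_{(x',y')\in C}\|(x',y')-(x,y)\|^2$. (In the paper, $\lambda_1$ is the minimum eigenvalue of a symmetric matrix and $\rho$ is a regularization parameter; they enter here only through $l$.) *)

(* Defs.v *)
From HB Require Import structures.
From mathcomp Require Import all_boot all_order all_algebra.
From mathcomp Require Import all_classical all_reals.

Set Implicit Arguments.
Unset Strict Implicit.
Unset Printing Implicit Defensive.

Import Order.TTheory GRing.Theory Num.Theory.

Local Open Scope classical_set_scope.
Local Open Scope ring_scope.

(* The Euclidean norm: the library norm `|x| on matrices is the sup norm, and
   on pairs it is the maximum of the norms of the components. *)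
Definition enorm (R : realType) (n : nat) (x : 'rV[R]_n) : R :=
  Num.sqrt (\sum_(i < n) x ord0 i ^+ 2).

Definition enorm_pair (R : realType) (n : nat) (p : 'rV[R]_n * R) : R :=
  Num.sqrt (enorm p.1 ^+ 2 + p.2 ^+ 2).

Definition argmin (R : realType) (T : Type) (C : set T) (f : T -> R) : set T :=
  [set q | C q /\ forall r, C r -> f q <= f r].

(* The minimizer exists and is unique when C is nonempty, closed and convex;
   the default value of xget plays no role in that case. *)
Definition orthproj (R : realType) (n : nat) (C : set ('rV[R]_n * R))
    (p : 'rV[R]_n * R) : 'rV[R]_n * R :=
  xget 0 (argmin C (fun q => enorm_pair (q - p) ^+ 2)).

Definition epi (R : realType) (n : nat) : set ('rV[R]_n * R) :=
  [set p | enorm p.1 ^+ 2 <= p.2].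

Definition epi_above (R : realType) (n : nat) (l : R) : set ('rV[R]_n * R) :=
  [set p | enorm p.1 ^+ 2 <= p.2 /\ l <= p.2].

(* Main.v *)
(** For a point [q] of [B], the segment from [q] to [(x1, y1)] stays in the
    convex set [S].  If [y1 < l] it meets the hyperplane [y = l], at a point no
    farther from [(x0, y0)] than [q], because the distance is convex along the
    segment and smallest on [S] at [(x1, y1)].  Hence the projection onto [B]
    lies in the slice [y = l], where it is the projection of [x0] onto the ball
    of radius [sqrt l].  For [(x0, y0)] outside [S], [(x1, y1)] comes from the KKT
    conditions [x1 = x0 / (1 + 2 mu)], [y1 = y0 + mu = |x1|^2]: the multiplier [mu] is a
    root of a cubic, obtained by the intermediate value theorem. *)

Require Import Defs.
From mathcomp Require Import all_boot all_order all_algebra.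
From mathcomp Require Import all_classical all_reals.
From mathcomp Require Import ring lra.

Set Implicit Arguments.
Unset Strict Implicit.

Import Order.TTheory GRing.Theory Num.Theory.

Local Open Scope classical_set_scope.
Local Open Scope ring_scope.

(** Writing $\|u\|^2$ as [dot u u] removes the square roots, so distance comparisons become
    polynomial. *)
Definition dot {R : realType} {n : nat} (u v : 'rV[R]_n) : R :=
  \sum_(i < n) u ord0 i * v ord0 i.

Lemma dotC (R : realType) (n : nat) (u v : 'rV[R]_n) : dot u v = dot v u.
Proof. by apply: eq_bigr => i _; rewrite mulrC. Qed.

Lemma dot_linear_l (R : realType) (n : nat) (a b : R) (u v w : 'rV[R]_n) :
  dot (a *: u + b *: v) w = a * dot u w + b * dot v w.
Proof.
rewrite /dot !mulr_sumr -big_split; apply: eq_bigr => i _ /=.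
by rewrite !mxE; ring.
Qed.

Lemma dot_linear_r (R : realType) (n : nat) (a b : R) (u v w : 'rV[R]_n) :
  dot w (a *: u + b *: v) = a * dot w u + b * dot w v.
Proof. by rewrite dotC dot_linear_l !(dotC w). Qed.

Lemma sqnorm_comb (R : realType) (n : nat) (a b : R) (u v : 'rV[R]_n) :
  dot (a *: u + b *: v) (a *: u + b *: v) =
  a ^+ 2 * dot u u + 2 * (a * b) * dot u v + b ^+ 2 * dot v v.
Proof. by rewrite dot_linear_l !dot_linear_r (dotC v u); ring. Qed.

Lemma sqnormB (R : realType) (n : nat) (u v : 'rV[R]_n) :
  dot (u - v) (u - v) = dot u u - 2 * dot u v + dot v v.
Proof.
by rewrite -[u in LHS]scale1r -[v in LHS]scale1r -scaleNr sqnorm_comb; ring.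
Qed.

Lemma sqnormZ (R : realType) (n : nat) (a : R) (u : 'rV[R]_n) :
  dot (a *: u) (a *: u) = a ^+ 2 * dot u u.
Proof. by rewrite -[_ *: u]addr0 -(scale0r u) sqnorm_comb; ring. Qed.

Lemma dotZl (R : realType) (n : nat) (a : R) (u v : 'rV[R]_n) :
  dot (a *: u) v = a * dot u v.
Proof. by rewrite -[_ *: u]addr0 -(scale0r u) dot_linear_l; ring. Qed.

Lemma sqnorm_ge0 (R : realType) (n : nat) (u : 'rV[R]_n) : 0 <= dot u u.
Proof. by apply: sumr_ge0 => i _; rewrite -expr2 sqr_ge0. Qed.

Lemma sqnorm_eq0 (R : realType) (n : nat) (u : 'rV[R]_n) :
  dot u u = 0 -> u = 0.
Proof.
move=> u0; apply/rowP => i; rewrite mxE; apply/eqP.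
rewrite -sqrf_eq0 expr2.
have /psumr_eq0P : forall j : 'I_n, true -> 0 <= u ord0 j * u ord0 j.
  by move=> j _; rewrite -expr2 sqr_ge0.
by move=> /(_ u0 i isT) ->.
Qed.

Lemma enorm_ge0 (R : realType) (n : nat) (u : 'rV[R]_n) : 0 <= enorm u.
Proof. exact: sqrtr_ge0. Qed.

Lemma enorm_sqr (R : realType) (n : nat) (u : 'rV[R]_n) :
  enorm u ^+ 2 = dot u u.
Proof.
rewrite /enorm (eq_bigr (fun i => u ord0 i * u ord0 i)) ?sqr_sqrtr //.
exact: sqnorm_ge0.
Qed.

Definition sqdist {R : realType} {n : nat} (q p : 'rV[R]_n * R) : R :=
  enorm_pair (q - p) ^+ 2.

Lemma sqdistE (R : realType) (n : nat) (q p : 'rV[R]_n * R) :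
  sqdist q p = dot (q.1 - p.1) (q.1 - p.1) + (q.2 - p.2) ^+ 2.
Proof.
rewrite /sqdist /enorm_pair sqr_sqrtr ?enorm_sqr //.
by rewrite addr_ge0 ?sqnorm_ge0 ?sqr_ge0.
Qed.

Lemma sqdist_le0 (R : realType) (n : nat) (q p : 'rV[R]_n * R) :
  sqdist q p <= 0 -> q = p.
Proof.
case: q p => [x y] [x' y']; rewrite sqdistE /= => h.
have h1 := sqnorm_ge0 (x - x'); have h2 := sqr_ge0 (y - y').
have /sqnorm_eq0/eqP : dot (x - x') (x - x') = 0 by lra.
have /eqP : (y - y') ^+ 2 = 0 by lra.
by rewrite sqrf_eq0 !subr_eq0 => /eqP -> /eqP ->.
Qed.

Definition segment {R : realType} {n : nat} (t : R) (a b : 'rV[R]_n * R) :=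
  ((1 - t) *: a.1 + t *: b.1, (1 - t) * a.2 + t * b.2).

Definition convex_set {R : realType} {n : nat} (C : set ('rV[R]_n * R)) :=
  forall (t : R) a b, 0 <= t <= 1 -> C a -> C b -> C (segment t a b).

(** Stewart's identity; its last term expresses strong convexity of the squared distance. *)
Lemma sqdist_segment (R : realType) (n : nat) (t : R) (a b p : 'rV[R]_n * R) :
  sqdist (segment t a b) p =
  (1 - t) * sqdist a p + t * sqdist b p - t * (1 - t) * sqdist a b.
Proof.
rewrite !sqdistE /= !sqnormB sqnorm_comb dot_linear_l; ring.
Qed.

(** The convexity defect of the squared norm is $t(1-t)\|x_a-x_b\|^2\ge 0$. *)
Lemma convex_epi (R : realType) (n : nat) : convex_set (@epi R n).
Proof.
move=> t [xa ya] [xb yb] t01; rewrite /epi /= !enorm_sqr sqnorm_comb => ha hb.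
have := sqnorm_ge0 (xa - xb); rewrite sqnormB => h.
have {}h : 0 <= (t * (1 - t)) * (dot xa xa - 2 * dot xa xb + dot xb xb).
  by rewrite mulr_ge0 // mulr_ge0 //; lra.
have {}ha : (1 - t) * dot xa xa <= (1 - t) * ya by rewrite ler_wpM2l //; lra.
have {}hb : t * dot xb xb <= t * yb by rewrite ler_wpM2l //; lra.
lra.
Qed.

Lemma convex_epi_above (R : realType) (n : nat) (l : R) :
  convex_set (@epi_above R n l).
Proof.
move=> t a b t01 [ha la] [hb lb]; split; first exact: convex_epi.
rewrite /=.
have h1 : (1 - t) * l <= (1 - t) * a.2 by rewrite ler_wpM2l //; lra.
have h2 : t * l <= t * b.2 by rewrite ler_wpM2l //; lra.
lra.
Qed.

(** Two minimizers at positive distance would both be beaten by their midpoint. *)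
Lemma argmin_unique (R : realType) (n : nat) (C : set ('rV[R]_n * R))
    (p q r : 'rV[R]_n * R) : convex_set C ->
  argmin C (fun z => sqdist z p) q -> argmin C (fun z => sqdist z p) r -> q = r.
Proof.
move=> cC [Cq hq] [Cr hr]; apply: sqdist_le0.
have t01 : 0 <= (2^-1 : R) <= 1 by lra.
have := hq _ (cC _ _ _ t01 Cq Cr); rewrite sqdist_segment.
have := hr _ Cq; lra.
Qed.

Lemma orthproj_eq (R : realType) (n : nat) (C : set ('rV[R]_n * R))
    (p q : 'rV[R]_n * R) : convex_set C ->
  argmin C (fun z => sqdist z p) q -> orthproj C p = q.
Proof.
move=> cC hq; apply: xget_unique => // r hr.
exact: argmin_unique cC hr hq.
Qed.

(** With $y_1=y_0+\mu$, the gain in squared distance from $(x_1,y_1)$ to $(x,y)$ is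
    $\|x-x_1\|^2+(y-y_1)^2$ plus $2\mu$ times the bracket in [hm]. *)
Lemma epi_argmin_kkt (R : realType) (n : nat) (x0 x1 : 'rV[R]_n)
    (y0 mu : R) : 0 <= mu -> x0 = (1 + 2 * mu) *: x1 ->
  y0 + mu = dot x1 x1 ->
  argmin (@epi R n) (fun z => sqdist z (x0, y0)) (x1, y0 + mu).
Proof.
move=> mu0 -> e; split; first by rewrite /epi /= enorm_sqr e.
case=> x y; rewrite /epi /= enorm_sqr => hy.
rewrite !sqdistE /= !sqnormB sqnormZ !(dotC _ (_ *: _)) !dotZl (dotC x1 x).
have := sqnorm_ge0 (x - x1); rewrite sqnormB => h.
(* As $y\ge\|x\|^2$ and $y_1=\|x_1\|^2$, the bracket is at least $\|x-x_1\|^2$. *)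
have hm : 0 <= mu * (y - (y0 + mu) - 2 * dot x x1 + 2 * dot x1 x1).
  by rewrite mulr_ge0 // e; lra.
have := sqr_ge0 (y - (y0 + mu)); rewrite -e in h hm *.
nra.
Qed.

(** This cubic is $y_0+\mu=\|x_1\|^2$ after substituting $x_1=x_0/(1+2\mu)$, with $a=\|x_0\|^2$. *)
Lemma kkt_multiplier (R : realType) (y0 a : R) : 0 <= a -> y0 <= a ->
  exists2 mu, 0 <= mu & (y0 + mu) * (1 + 2 * mu) ^+ 2 = a.
Proof.
move=> a0 ya.
pose p : {poly R} := (y0%:P + 'X) * (1 + 2%:P * 'X) ^+ 2 - a%:P.
have pE m : p.[m] = (y0 + m) * (1 + 2 * m) ^+ 2 - a by rewrite !hornerE.
(* Take $u=\max(0,-y_0)$. At $u+a$ the linear factor is at least $a$ and the squared one at least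
   $1$, so the sign changes on $[u,u+a]$. *)
have [u [u0 yu pu]] : exists u, [/\ 0 <= u, 0 <= y0 + u & p.[u] <= 0].
  case: (lerP 0 y0) => y00; [exists 0|exists (- y0)].
    by split; rewrite ?pE; lra.
  by split; rewrite ?pE; lra.
have uv : u <= u + a by lra.
have pv : 0 <= p.[u + a].
  rewrite pE.
  have : 1 <= (1 + 2 * (u + a)) ^+ 2 by rewrite expr_ge1 //; lra.
  have : a <= y0 + (u + a) by lra.
  by nra.
have [m /andP[um _] /rootP] := @poly_ivt _ p u (u + a) uv (introT andP (conj pu pv)).
by rewrite pE => hm; exists m; lra.
Qed.

Lemma epi_argmin_exists (R : realType) (n : nat) (p : 'rV[R]_n * R) :
  exists q, argmin (@epi R n) (fun z => sqdist z p) q.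
Proof.
case: p => x0 y0; have [h|h] := leP (dot x0 x0) y0.
  exists (x0, y0); split; first by rewrite /epi /= enorm_sqr.
  move=> r _; rewrite [leLHS](_ : _ = 0) ?sqr_ge0 //.
  by rewrite sqdistE /= sqnormB; ring.
have [mu mu0 e] := kkt_multiplier (sqnorm_ge0 x0) (ltW h).
have m0 : 1 + 2 * mu != 0 by apply: lt0r_neq0; lra.
exists ((1 + 2 * mu)^-1 *: x0, y0 + mu); apply: epi_argmin_kkt => //.
  by rewrite scalerA divff // scale1r.
by rewrite sqnormZ -e; field.
Qed.

Lemma orthproj_epiP (R : realType) (n : nat) (p : 'rV[R]_n * R) :
  argmin (@epi R n) (fun z => sqdist z p) (orthproj (@epi R n) p).
Proof.
have [q hq] := epi_argmin_exists p.
by rewrite (orthproj_eq (@convex_epi R n) hq).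
Qed.

(** If $l\le y_0$, lifting $(x_1,y_1)$ to height $l$ would stay in $S$ and come strictly closer to
    $(x_0,y_0)$. *)
Lemma argmin_epi_lt (R : realType) (n : nat) (x0 x1 : 'rV[R]_n) (y0 y1 l : R) :
  argmin (@epi R n) (fun z => sqdist z (x0, y0)) (x1, y1) -> y1 < l -> y0 < l.
Proof.
move=> [S1 min1] y1l; rewrite ltNge; apply/negP => ly0.
have : epi (x1, l) by apply: le_trans S1 (ltW y1l).
by move=> /min1; rewrite !sqdistE /=; nra.
Qed.

Lemma epi_above_slice (R : realType) (n : nat) (p p1 q : 'rV[R]_n * R) (l : R) :
  argmin (@epi R n) (fun z => sqdist z p) p1 -> p1.2 < l -> epi_above l q ->
  exists2 x, dot x x <= l & sqdist (x, l) p <= sqdist q p.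
Proof.
move=> [S1 min1] y1l [Sq lq].
have d0 : 0 < q.2 - p1.2 by rewrite subr_gt0 (lt_le_trans y1l).
(* The parameter at which the segment from [p1] to [q] reaches height $l$. *)
pose t := (l - p1.2) / (q.2 - p1.2).
have t01 : 0 <= t <= 1.
  by rewrite /t ler_pdivlMr // ler_pdivrMr //; lra.
have e : segment t p1 q = (((1 - t) *: p1.1 + t *: q.1), l).
  by rewrite /segment /t; congr (_, _); field; apply: lt0r_neq0.
exists ((1 - t) *: p1.1 + t *: q.1).
  by have := convex_epi t01 S1 Sq; rewrite e /epi /= enorm_sqr.
rewrite -e sqdist_segment.
have h1 : (1 - t) * sqdist p1 p <= (1 - t) * sqdist q p.
  by rewrite ler_wpM2l ?min1 //; lra.
have h2 : 0 <= t * (1 - t) * sqdist p1 q.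
  by rewrite mulr_ge0 ?sqr_ge0 // mulr_ge0 //; lra.
lra.
Qed.

Theorem theorem3p1 (R : realType) (n : nat) (lambda1 rho : R)
    (lambda1_lt0 : lambda1 < 0) (rho_gt0 : 0 < rho)
    (x0 : 'rV[R]_n) (y0 : R) :
  let l := lambda1 ^+ 2 / rho ^+ 2 in
  let S := @epi R n in
  let B := @epi_above R n l in
  let: (x1, y1) := orthproj S (x0, y0) in
  orthproj B (x0, y0) =
    if l <= y1 then (x1, y1)
    else if enorm x0 < Num.sqrt l then (x0, l)
    else ((Num.sqrt l / enorm x0) *: x0, l).
Proof.
move=> l S B; have := orthproj_epiP (x0, y0); rewrite -/S.
case: (orthproj S _) => x1 y1 min1.
have l0 : 0 < l by rewrite divr_gt0 ?(exprn_gt0 _ rho_gt0) // exprn_even_gt0 //= lt_eqF.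
have s0 : 0 < Num.sqrt l by rewrite sqrtr_gt0.
have s2 : Num.sqrt l ^+ 2 = l by rewrite sqr_sqrtr // ltW.
apply: orthproj_eq; first exact: convex_epi_above.
have [ly1|y1l] := leP l y1.
  by case: min1 => S1 min1; split=> // r [Sr _]; exact: min1.
have y0l := argmin_epi_lt min1 y1l.
have [xl|lx] := ltP (enorm x0) (Num.sqrt l).
  split; first by split=> //=; have := enorm_ge0 x0; rewrite -s2; nra.
  (* Only the vertical distance remains at $(x_0,l)$, and $y_0<l\le y$ makes it minimal. *)
  case=> x y [_ /= ly]; rewrite !sqdistE /= subrr.
  have := sqnorm_ge0 (x - x0); rewrite -[0]subr0 sqnormB.
  have -> : dot (0 : 'rV[R]_n) 0 = 0 by rewrite -(scale0r x0) sqnormZ; ring.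
  by nra.
have a0 : 0 < enorm x0 by exact: lt_le_trans lx.
set k := Num.sqrt l / enorm x0.
have k0 : 0 < k by rewrite divr_gt0.
have k1 : k <= 1 by rewrite ler_pdivrMr // mul1r.
have sqc : k ^+ 2 * dot x0 x0 = l.
  by rewrite -enorm_sqr -[RHS]s2 /k; field; apply: lt0r_neq0.
split; first by split; rewrite //= enorm_sqr sqnormZ sqc.
move=> q /(epi_above_slice min1 y1l)[x xl]; apply: le_trans.
rewrite !sqdistE /= !sqnormB sqnormZ sqc lerD2r dotZl.
have := sqnorm_ge0 (x - k *: x0).
rewrite sqnormB dotC dotZl (dotC x0 x) sqnormZ sqc => h.
(* Expanding $\|x-kx_0\|^2\ge 0$ with $\|x\|^2\le l=\|kx_0\|^2$ bounds the inner product, as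
   Cauchy-Schwarz would. *)
have wa : dot x x0 <= k * dot x0 x0.
  by rewrite -(ler_pM2l k0) mulrA -expr2 sqc; lra.
(* Since $k\le 1$, this bound controls the part of $2\langle x,x_0\rangle$ that [h] leaves over. *)
have : (1 - k) * dot x x0 <= (1 - k) * (k * dot x0 x0).
  by rewrite ler_wpM2l //; lra.
lra.
Qed.
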